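(* Let $n\ge 2$ be an integer, let $p,r\in\mathbb{R}$, and let $\phi\colon\mathbb{D}_{2n}\to\mathbb{R}$ be the function with $\phi(e)=1$, $\phi(s)=\phi(t)=p$ and $\phi(w)=r$ for all other $w\in\mathbb{D}_{2n}$. Then $\phi$ is positive definite on $\mathbb{D}_{2n}$ if and only if $$\max\left\{\frac{-2p-1}{2n-3},\,2p-1\right\}\le r\le\frac{1+2p\cos(\pi/n)}{1+2\cos(\pi/n)},$$ i.e. if and only if the point $(p,r)$ belongs to the triangle (in $\mathbb{R}^2$) whose vertices are $$\left(\frac{1-n-\cos(\pi/n)}{1+(2n-1)\cos(\pi/n)},\ \frac{1-\cos(\pi/n)}{1+(2n-1)\cos(\pi/n)}\right),\quad \left(\frac{n-2}{2n-2},\ \frac{-1}{n-1}\right),\quad (1,1).$$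
   Context: $\mathbb{D}_{2n}=\langle s,t\mid s^2=t^2=(st)^n=1\rangle$ is the dihedral group of order $2n$ with Coxeter generators $s,t$. A function $\varphi\colon\Gamma\to\mathbb{C}$ on a group $\Gamma$ is positive definite if $\sum_{x,y\in\Gamma}\varphi(y^{-1}x)\alpha(x)\overline{\alpha(y)}\ge 0$ for every finitely supported $\alpha\colon\Gamma\to\mathbb{C}$. ''Triangle'' means the closed triangle, i.e. the convex hull of its vertices. *)

(* Defs.v *)
From HB Require Import structures.
From mathcomp Require Import all_boot all_order all_algebra all_fingroup.
From mathcomp Require presentation extremal.
From mathcomp Require Import all_classical all_reals.
From mathcomp Require Import convex trigo.
From mathcomp Require Import complex.

Set Implicit Arguments.
Unset Strict Implicit.
Unset Printing Implicit Defensive.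

Import Order.TTheory GRing.Theory Num.Theory.
Local Open Scope classical_set_scope.
Local Open Scope ring_scope.

(* [0 <= z] in [R[i]] means that [z] is real and nonnegative.  The sums over
   [setT] are finitely supported because [alpha] is. *)
Definition positive_definite (R : rcfType) (G : groupType) (phi : G -> R[i]) :=
  forall alpha : G -> R[i], finite_set [set x | alpha x != 0] ->
    0 <= \sum_(x \in [set: G]) \sum_(y \in [set: G])
           phi (y^-1 * x)%g * alpha x * (alpha y)^*.

(* The argument of the library's [dihedral_gtype] is the order of the group,
   hence [2 * n]. *)
Definition dihedral (n : nat) : finGroupType := extremal.dihedral_gtype (2 * n).

(* For [n >= 2] the group presented by [s^2 = t^2 = (st)^n = 1] has the same
   finite order [2n] as [dihedral n], so a generating pair of [dihedral n]
   satisfying the relations is a pair of Coxeter generators: the surjection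
   from the presented group is an isomorphism. *)
Definition coxeter_generators (n : nat) (s t : dihedral n) : Prop :=
  [/\ <<[set s; t]%SET>>%g = [set: dihedral n]%SET,
      (s ^+ 2 = 1)%g, (t ^+ 2 = 1)%g & ((s * t) ^+ n = 1)%g].

Lemma card_dihedral_gens (n : nat) : (2 <= n)%N ->
  #|dihedral n| = (2 * n)%N /\ exists s t : dihedral n, coxeter_generators s t.
Proof.
move=> n2; rewrite /coxeter_generators /dihedral mul2n; split.
  by rewrite -cardsT extremal.card_dihedral.
have : ([set: extremal.dihedral_gtype n.*2]%SET \homg
         [set: extremal.dihedral_gtype n.*2]%SET)%g by exact: homg_refl.
rewrite (extremal.Grp'_dihedral n2) => /existsP[[s t]] /=.
rewrite !xpair_eqE => /and4P[/eqP g /eqP s2 /eqP t2 /eqP st].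
by exists s, t; split => //; rewrite -g joing_idl joing_idr.
Qed.

Definition convex_hull (R : numDomainType) (M : lmodType R) (A : set M) :
    set M :=
  \bigcap_(C in [set C : set M |
                  @convex_set R M (C : set (convex_lmodType M)) /\ A `<=` C]) C.

Definition triangle (R : numDomainType) (a b c : R * R) : set (R * R) :=
  @convex_hull R (R^o * R^o)%type [set a; b; c].

(* Main.v *)
Require Import Defs.
From HB Require Import structures.
From mathcomp Require Import all_boot all_order all_algebra all_fingroup.
From mathcomp Require Import all_classical all_reals.
From mathcomp Require Import convex trigo.
From mathcomp Require Import complex.
From mathcomp Require Import interval_inference.
From mathcomp Require Import ring lra zify.

Set Implicit Arguments.
Unset Strict Implicit.
Unset Printing Implicit Defensive.

Import Order.TTheory GRing.Theory Num.Theory.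
Local Open Scope classical_set_scope.
Local Open Scope ring_scope.

(** The value of [phi] at [y^-1 x] only depends on how far [x] and [y] are from
    each other in the Cayley graph of the dihedral group, and that Cayley graph
    is a cycle of length [2n]: the right multiplications by [s] and [t] move
    along its edges.  Numbering its vertices by [Z/2n] ([dihedral_walk_bij],
    [dihedral_walk_neighbour]) turns the form in the definition of positive
    definiteness into the form of the circulant kernel [K (k - l)], where
    [K 0 = 1], [K (+-1) = p] and [K] is [r] elsewhere.

    Circulant forms are diagonalised by the characters of [Z/2n]
    ([bochner_unitary_pairing]), so [phi] is positive definite if and only if
    all the eigenvalues
    [2n r [j = 0] + (1 - r) + 2 (p - r) cos (j pi / n)] are nonnegative
    ([dihedral_spectrum]).  For [j != 0] the cosine runs between [-1], reached
    at [j = n], and [cos (pi / n)], reached at [j = 1]; an affine function of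
    the cosine is nonnegative on all these values as soon as it is at the two
    extreme ones.  Three affine inequalities remain, for [j = 0], [1], [n]
    ([positive_definite_dihedralP]).

    Solving these inequalities for [r] gives the interval.  They also bound
    the triangle: each of the three affine forms vanishes at two of the
    vertices and is positive at the third one, hence, up to scaling, the three
    forms are the barycentric coordinates ([ineqs_triangle]). *)

(** * Positive definite functions on a finite abelian group *)

(** A self-duality of [V]: the [chi j] are all the characters of [V], indexed by
    [V] itself.  The last clause, that a nonzero element is detected by some
    character, is what makes the characters orthogonal. *)
Definition unitary_pairing (C : numClosedFieldType) (V : finZmodType)
    (chi : V -> V -> C) : Prop :=
  [/\ forall j, {morph chi j : k l / k + l >-> k * l},
      forall j k, chi j k = chi k j,
      forall j k, `|chi j k| = 1 &
      forall k, k != 0 -> exists j, chi j k != 1].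

Lemma unitary_pairing0 (C : numClosedFieldType) (V : finZmodType)
    (chi : V -> V -> C) (j : V) : unitary_pairing chi -> chi j 0 = 1.
Proof.
case=> chiD _ chi1 _.
have nz : chi j 0 != 0 by rewrite -normr_eq0 chi1 oner_eq0.
by apply: (mulfI nz); rewrite -chiD addr0 mulr1.
Qed.

Lemma unitary_pairing_conj (C : numClosedFieldType) (V : finZmodType)
    (chi : V -> V -> C) (j k : V) :
  unitary_pairing chi -> (chi j k)^* = chi j (- k).
Proof.
move=> h; have [chiD _ chi1 _] := h.
have nz : chi j k != 0 by rewrite -normr_eq0 chi1 oner_eq0.
by apply: (mulfI nz); rewrite -normCK chi1 expr1n -chiD subrr unitary_pairing0.
Qed.

(** Orthogonality: translating the index [j] by some [i] with [chi i k != 1]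
    multiplies the sum by [chi i k], so the sum vanishes. *)
Lemma unitary_pairing_sum (C : numClosedFieldType) (V : finZmodType)
    (chi : V -> V -> C) (k : V) : unitary_pairing chi ->
  \sum_j chi j k = if k == 0 then #|V|%:R else 0.
Proof.
move=> h; have [chiD chiC _ chi_nd] := h.
case: eqP => [->|/eqP k0].
  by under eq_bigr do rewrite unitary_pairing0 //; rewrite sumr_const.
have [i hi] := chi_nd k k0.
have : chi i k * \sum_j chi j k = \sum_j chi j k.
  rewrite mulr_sumr [RHS](reindex_inj (addrI i)) /=; apply: eq_bigr => j _.
  by rewrite (chiC (i + j)) chiD chiC (chiC k j).
move/eqP; rewrite -[X in _ == X]mul1r -subr_eq0 -mulrBl mulf_eq0 subr_eq0.
by rewrite (negPf hi) => /eqP.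
Qed.

(** Bochner's theorem for a finite group.  By Fourier inversion the form equals
    [\sum_j f j * `|\sum_k chi j k * a k| ^+ 2 / #|V|], where [f] is the Fourier
    transform of [K]; testing it on a character isolates a single [f j]. *)
Lemma bochner_unitary_pairing (C : numClosedFieldType) (V : finZmodType)
    (chi : V -> V -> C) (K : V -> C) : unitary_pairing chi ->
  (forall a : V -> C, 0 <= \sum_k \sum_l K (k - l) * a k * (a l)^*) <->
  (forall j, 0 <= \sum_m K m * chi j (- m)).
Proof.
move=> h; have [chiD chiC chi1 _] := h.
have V0 : 0 < #|V|%:R :> C by rewrite ltr0n; apply/card_gt0P; exists 0.
pose f j := \sum_m K m * chi j (- m).
split=> [K_pd j|f_ge0 a].
  have := K_pd (fun k => chi j (- k)).
  rewrite [X in 0 <= X](_ : _ = #|V|%:R * f j) ?pmulr_rge0 //.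
  rewrite mulr_natl -sumr_const exchange_big /=; apply: eq_big => // l _.
  rewrite /f (reindex_inj (addIr l)) /=; apply: eq_bigr => m _.
  by rewrite addrK unitary_pairing_conj // -mulrA -chiD opprK opprD subrK.
(* Fourier inversion *)
have inv m : #|V|%:R * K m = \sum_j f j * chi j m.
  under eq_bigr do rewrite mulr_suml.
  rewrite exchange_big (bigD1 m) //= [X in _ + X]big1 => [|i im].
    under eq_bigr do rewrite -mulrA -chiD addNr.
    by rewrite -mulr_sumr unitary_pairing_sum // eqxx addr0 mulrC.
  under eq_bigr do rewrite -mulrA -chiD.
  by rewrite -mulr_sumr unitary_pairing_sum // addrC subr_eq0 eq_sym (negPf im) mulr0.
rewrite -(pmulr_rge0 _ V0) [X in 0 <= X](_ : _ =
    \sum_j f j * `|\sum_k chi j k * a k| ^+ 2); last first.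
  rewrite mulr_sumr.
  transitivity (\sum_k \sum_l \sum_j f j * (chi j k * a k * (chi j l * a l)^*)).
    apply: eq_bigr => k _; rewrite mulr_sumr; apply: eq_bigr => l _.
    rewrite !mulrA inv !mulr_suml; apply: eq_bigr => j _.
    rewrite chiD -unitary_pairing_conj // rmorphM /=; ring.
  under eq_bigr do rewrite exchange_big /=.
  rewrite exchange_big; apply: eq_bigr => j _.
  rewrite normCK rmorph_sum mulr_suml mulr_sumr; apply: eq_bigr => k _.
  by rewrite -!mulr_sumr.
by apply: sumr_ge0 => j _; rewrite mulr_ge0 ?f_ge0 ?exprn_ge0.
Qed.

Lemma Zp_neq0_bounds (N : nat) (k : 'Z_N) :
  (1 < N)%N -> k != 0 -> (0 < k < N)%N.
Proof.
move=> N1 k0; rewrite lt0n -[X in (_ < X)%N](Zp_cast N1) ltn_ord andbT.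
exact: k0.
Qed.

Lemma unitary_pairing_Zp (C : numClosedFieldType) (N : nat) (w : C) :
  (1 < N)%N -> w ^+ N = 1 -> (forall k, (0 < k < N)%N -> w ^+ k != 1) ->
  unitary_pairing (fun j k : 'Z_N => w ^+ (j * k)%N).
Proof.
move=> N1 wN w_neq1.
have N_gt0 : (0 < N)%N by exact: ltnW.
have modZ m : (m %% (Zp_trunc N).+2 = m %% N)%N by rewrite Zp_cast.
have w_mod m : w ^+ (m %% N)%N = w ^+ m.
  by rewrite [in RHS](divn_eq m N) exprD mulnC exprM wN expr1n mul1r.
split.
- move=> j k l /=; rewrite modZ -exprD -mulnDr.
  by rewrite -w_mod modnMmr w_mod.
- by move=> j k; rewrite mulnC.
- move=> j k; rewrite normrX.
  suff -> : `|w| = 1 by rewrite expr1n.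
  by apply/eqP; rewrite -(pexpr_eq1 N_gt0) // -normrX wN normr1.
- move=> k k0; exists 1; rewrite /= modZ modn_small // mul1n w_neq1 //.
  exact: Zp_neq0_bounds.
Qed.

(** * The Cayley graph of a dihedral group is a cycle *)

Section walk.
Local Open Scope group_scope.

(** The alternating product [s t s ...] of [k] letters: the position after [k]
    steps of the walk from [1] that never turns back. *)
Definition dihedral_walk (gT : finGroupType) (s t : gT) (k : nat) : gT :=
  (s * t) ^+ k./2 * s ^+ odd k.

Lemma dihedral_walkS (gT : finGroupType) (s t : gT) (k : nat) :
  s ^+ 2 = 1 ->
  dihedral_walk s t k.+1 = dihedral_walk s t k * (if odd k then t else s).
Proof.
move=> s2; rewrite /dihedral_walk /= uphalf_half; case: (odd k) => /=.
  by rewrite add1n expg0 mulg1 expgSr expg1 !mulgA.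
by rewrite add0n expg0 mulg1.
Qed.

Lemma dihedral_walk_mod (gT : finGroupType) (s t : gT) (n k : nat) :
  (s * t) ^+ n = 1 ->
  dihedral_walk s t (k %% (2 * n))%N = dihedral_walk s t k.
Proof.
move=> st; rewrite [in RHS](divn_eq k (2 * n)) /dihedral_walk.
set q := (k %/ _)%N; set m := (k %% _)%N.
have -> : (q * (2 * n) + m = (q * n).*2 + m)%N by rewrite -muln2; lia.
rewrite halfD odd_double doubleK add0n oddD odd_double /=.
by rewrite expgD mulnC expgM st expg1n mul1g.
Qed.

End walk.

Section walkZ.
Variables (gT : finGroupType) (s t : gT) (n : nat).
Hypothesis n2 : (2 <= n)%N.
Hypothesis s2 : (s ^+ 2 = 1)%g.
Hypothesis t2 : (t ^+ 2 = 1)%g.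
Hypothesis stn : ((s * t) ^+ n = 1)%g.

Let walk (k : 'Z_(2 * n)) := dihedral_walk s t k.

Let N1 : (1 < 2 * n)%N.
Proof. by lia. Qed.

Let modZ m : (m %% (Zp_trunc (2 * n)).+2 = m %% (2 * n))%N.
Proof. by rewrite Zp_cast. Qed.

Lemma dihedral_walkD1 (k : 'Z_(2 * n)) :
  walk (k + 1) = (walk k * (if odd k then t else s))%g.
Proof.
rewrite -dihedral_walkS // /walk /= !modZ dihedral_walk_mod //.
by rewrite [(1 %% _)%N]modn_small ?addn1.
Qed.

(** The parity of a residue makes sense because the modulus is even. *)
Lemma odd_ZpB1 (k : 'Z_(2 * n)) : odd (k - 1)%R = ~~ odd k.
Proof.
have -> : odd k = odd (k - 1 + 1)%R by rewrite subrK.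
move: (k - 1) => l; rewrite /= !modZ [(1 %% _)%N]modn_small //.
by rewrite odd_mod ?oddM // oddD addbT negbK.
Qed.

Lemma dihedral_walkB1 (k : 'Z_(2 * n)) :
  walk (k - 1) = (walk k * (if odd k then s else t))%g.
Proof.
rewrite -[in RHS](subrK 1 k) dihedral_walkD1 subrK odd_ZpB1.
by case: (odd k); rewrite -mulgA -expg2 ?s2 ?t2 mulg1.
Qed.

(** The vertices visited by the walk contain [1] and are stable under the right
    multiplications by [s] and [t], which step forward or backward according
    to the parity, so the walk visits the whole generated group; injectivity
    follows by counting. *)
Lemma dihedral_walk_bij : <<[set s; t]%SET>>%g = [set: gT]%SET ->
  #|gT| = (2 * n)%N -> bijective walk.
Proof.
move=> gen card.
have cardZ : #|'Z_(2 * n)| = #|gT| by rewrite card card_ord Zp_cast.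
apply: inj_card_bij; last by rewrite cardZ.
apply/injectiveP/card_uniqP; rewrite size_map -cardE cardZ.
apply: eq_card => x; rewrite inE.
have : x \in <<[set s; t]%SET>>%g by rewrite gen inE.
case/gen_prodgP => m [c c_st ->] {x}.
suff [k <-] : exists k, walk k = (\prod_i c i)%g by exact: codom_f.
elim: m c c_st => [|m IH] c c_st.
  by exists 0; rewrite big_ord0 /walk /dihedral_walk /= expg0 mulg1.
rewrite big_ord_recr /=; have [//|k <-] := IH (fun i => c (widen_ord (leqnSn m) i)).
have := c_st ord_max; rewrite !inE.
case k_odd : (odd k); case/orP => /eqP ->.
- by exists (k - 1); rewrite dihedral_walkB1 k_odd.
- by exists (k + 1); rewrite dihedral_walkD1 k_odd.
- by exists (k + 1); rewrite dihedral_walkD1 k_odd.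
- by exists (k - 1); rewrite dihedral_walkB1 k_odd.
Qed.

Lemma dihedral_walk_neighbour (k l : 'Z_(2 * n)) : injective walk ->
  ((walk l)^-1 * walk k \in [set s; t]%SET)%g = (k - l == 1) || (k - l == -1).
Proof.
move=> walk_inj.
have inv1 x : ((walk l)^-1 * walk k == x)%g = (walk k == walk l * x)%g.
  by apply/eqP/eqP => [<-|->]; rewrite ?mulKVg ?mulKg.
rewrite !inE !inv1 !subr_eq ![_ + l]addrC.
rewrite -!(inj_eq walk_inj) dihedral_walkD1 dihedral_walkB1.
by case: (odd l); rewrite // orbC.
Qed.

End walkZ.

(** * Transfer of positive definiteness to an abelian group *)

Lemma fsbig_setT_fin (R : Type) (idx : R) (op : Monoid.com_law idx)
    (T : finType) (F : T -> R) :
  \big[op/idx]_(x \in [set: T]) F x = \big[op/idx]_x F x.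
Proof.
rewrite [RHS]fsbig_seq ?index_enum_uniq //; apply: eq_fsbigl.
by apply/seteqP; split=> x //= _; rewrite mem_index_enum.
Qed.

(** Positive definiteness only depends on the matrix [phi (y^-1 x)], so it can be
    tested on another group that yields the same matrix. *)
Lemma positive_definite_reindex (R : rcfType) (G : finGroupType)
    (V : finZmodType) (h : V -> G) (phi : G -> R[i]) (K : V -> R[i]) :
  bijective h -> (forall k l, phi ((h l)^-1 * h k)%g = K (k - l)) ->
  positive_definite phi <->
  (forall a : V -> R[i], 0 <= \sum_k \sum_l K (k - l) * a k * (a l)^*).
Proof.
move=> h_bij phiK.
have h_bij' : {on [pred x | true], bijective h} by exact: onW_bij.
have sumE a : \sum_(x \in [set: G]) \sum_(y \in [set: G])
      phi (y^-1 * x)%g * a x * (a y)^* =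
    \sum_k \sum_l K (k - l) * a (h k) * (a (h l))^*.
  rewrite fsbig_setT_fin (reindex h) //=; apply: eq_bigr => k _.
  rewrite fsbig_setT_fin (reindex h) //=; apply: eq_bigr => l _.
  by rewrite phiK.
split=> [phi_pd a|K_pd a _]; last by rewrite sumE.
have [g hK gK] := h_bij.
have := phi_pd (a \o g) finite_finset; rewrite sumE.
by under eq_bigr do under eq_bigr do rewrite /= !hK.
Qed.

(** * Characters of Z/2n and the eigenvalues of the kernel *)

Section cosines.
Variable R : realType.

Lemma cos_mul_pi_div_le (n k : nat) : (1 < n)%N -> (0 < k < 2 * n)%N ->
  cos (k%:R * (pi / n%:R)) <= cos (pi / n%:R) :> R.
Proof.
move=> n2 k2.
have n0 : 0 < n%:R :> R by rewrite ltr0n; lia.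
wlog kn : k k2 / (k <= n)%N => [hw|].
  have [/hw->//|nk] := leqP k n.
  (* Beyond [pi], reflect the angle: [cos (2 pi - x) = cos x]. *)
  have -> : k%:R * (pi / n%:R) = pi *+ 2 - (2 * n - k)%N%:R * (pi / n%:R) :> R.
    rewrite natrB; last by lia.
    rewrite natrM -mulr_natl; field; lra.
  by rewrite addrC cosD2pi cosN; apply: hw; lia.
have x0 : 0 <= pi / n%:R :> R by rewrite divr_ge0 ?pi_ge0 ?(ltW n0).
rewrite leNgt ltr_cos ?in_itv /= -?leNgt.
- by rewrite ler_peMl // ler1n; case/andP: k2.
- rewrite mulr_ge0 //= mulrCA ler_piMr ?pi_ge0 //.
  by rewrite ler_pdivrMr // mul1r ler_nat.
- by rewrite x0 ler_pdivrMr // ler_peMr ?pi_ge0 // ler1n; lia.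
Qed.

Lemma cos_pi_div_lt1 (n : nat) : (1 < n)%N -> cos (pi / n%:R) < 1 :> R.
Proof.
move=> n2; have n0 : 0 < n%:R :> R by rewrite ltr0n; lia.
rewrite -[ltRHS]cos0 ltr_cos ?in_itv /= ?lexx ?pi_ge0 ?divr_gt0 ?pi_gt0 //.
by rewrite divr_ge0 ?pi_ge0 ?(ltW n0) // ler_pdivrMr // ler_peMr ?pi_ge0 // ler1n; lia.
Qed.

Lemma cos_pi_div_ge0 (n : nat) : (1 < n)%N -> 0 <= cos (pi / n%:R) :> R.
Proof.
move=> n2; have n0 : 0 < n%:R :> R by rewrite ltr0n; lia.
apply: cos_ge0_pihalf; apply/andP; split.
  by rewrite (@le_trans _ _ 0) ?oppr_le0 ?divr_ge0 ?pi_ge0 ?(ltW n0).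
by rewrite ler_pM2l ?pi_gt0 // lef_pV2 ?posrE // ler_nat.
Qed.

Lemma de_moivre (x : R) (k : nat) :
  ((cos x +i* sin x) ^+ k = cos (k%:R * x) +i* sin (k%:R * x))%C.
Proof.
elim: k => [|k IH]; first by rewrite expr0 mul0r cos0 sin0.
rewrite exprSr IH mulrSr mulrDl mul1r cosD sinD.
by apply/eqP; rewrite eq_complex /=; apply/andP; split; apply/eqP; ring.
Qed.

End cosines.

(** The root [w = exp (i pi / n)] is primitive of order [2n]: its smaller powers
    have real part at most [cos (pi / n) < 1]. *)
Lemma dihedral_pairing (R : realType) (n : nat) : (1 < n)%N ->
  unitary_pairing (fun j k : 'Z_(2 * n) =>
    (cos (pi / n%:R) +i* sin (pi / n%:R))%C ^+ (j * k)%N : R[i]).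
Proof.
move=> n2; have n0 : 0 < n%:R :> R by rewrite ltr0n; lia.
apply: unitary_pairing_Zp; first by lia.
  rewrite de_moivre natrM.
  have -> : 2 * n%:R * (pi / n%:R) = pi *+ 2 :> R.
    by rewrite -mulr_natl; field; lra.
  by rewrite cos2pi sin2pi.
move=> k k2; rewrite de_moivre eq_complex negb_and /= lt_eqF //.
by rewrite (le_lt_trans (cos_mul_pi_div_le R n2 k2)) ?cos_pi_div_lt1.
Qed.

(** The kernel is [r] plus corrections supported at [0], [e] and [- e], which
    are three distinct points when [e != 0] and [e != - e]. *)
Lemma sum_neighbour_kernel (V : finZmodType) (C : comPzRingType) (e : V)
    (x p r : C) (F : V -> C) : e != 0 -> e != - e ->
  \sum_m (if m == 0 then x else if (m == e) || (m == - e) then p else r) * F m =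
  r * \sum_m F m + (x - r) * F 0 + (p - r) * (F e + F (- e)).
Proof.
move=> e0 ee.
have delta a c : c * F a = \sum_m (if m == a then c else 0) * F m.
  rewrite (bigD1 a) //= eqxx big1 ?addr0 // => m /negPf ->.
  by rewrite mul0r.
rewrite mulrDr !delta mulr_sumr -!big_split /=; apply: eq_bigr => m _.
rewrite -!mulrDl; congr (_ * _).
have [->|_] := eqVneq m 0.
  by rewrite eq_sym (negPf e0) eq_sym oppr_eq0 (negPf e0) !addr0 addrC subrK.
have [->|_] := eqVneq m e; first by rewrite (negPf ee) /= !addr0 addrC subrK.
by case: eqP => _; rewrite /= ?addr0 // add0r addrC subrK.
Qed.

Lemma dihedral_spectrum (R : realType) (n : nat) (p r : R) (j : 'Z_(2 * n)) :
  (1 < n)%N ->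
  \sum_(m : 'Z_(2 * n))
     (if m == 0 then 1 else if (m == 1) || (m == -1) then p%:C else r%:C)%C *
     (cos (pi / n%:R) +i* sin (pi / n%:R))%C ^+ (j * (- m)%R)%N =
  ((if j == 0 then 2 * n%:R * r else 0) + (1 - r) +
     (p - r) * (2 * cos (j%:R * (pi / n%:R))))%:C%C.
Proof.
move=> n2; have N1 : (1 < 2 * n)%N by lia.
have N3 : (3 < 2 * n)%N by lia.
pose chi (j k : 'Z_(2 * n)) : R[i] :=
  (cos (pi / n%:R) +i* sin (pi / n%:R))%C ^+ (j * k)%N.
have h : unitary_pairing chi := dihedral_pairing R n2.
have [_ chiC _ _] := h.
have e0 : 1 != 0 :> 'Z_(2 * n) by exact: oner_neq0.
(* [1] and [-1] differ because the cycle has length at least 4. *)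
have ee : 1 != -1 :> 'Z_(2 * n).
  by rewrite -addr_eq0 -val_eqE /= Zp_cast // !modn_small //; lia.
rewrite (sum_neighbour_kernel _ _ _ (fun m => chi j (- m)) e0 ee).
rewrite oppr0 opprK (unitary_pairing0 _ h) addrC (addrC (chi j (-1))).
have -> : \sum_m chi j (- m) = if j == 0 then (2 * n%:R)%:C%C else 0.
  rewrite (reindex_inj oppr_inj) /=.
  under eq_bigr do rewrite opprK chiC.
  rewrite (unitary_pairing_sum _ h); case: (j == 0) => //.
  by rewrite card_ord Zp_cast // -natrM rmorph_nat.
have -> : chi j 1 + chi j (-1) = (2 * cos (j%:R * (pi / n%:R)))%:C%C.
  rewrite -(unitary_pairing_conj _ _ h) addcJ.
  have one1 : (1 : 'Z_(2 * n)) = 1%N :> nat by rewrite /= Zp_cast // modn_small.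
  rewrite /chi one1 muln1 de_moivre /=.
  by rewrite rmorphM rmorph_nat.
rewrite mulr1 !rmorphD !rmorphM !rmorphB rmorph1 /=.
by case: ifP => _; rewrite ?rmorphM ?rmorph0 /=; ring.
Qed.

(** The eigenvalues at [j = 0], [1] and [n] are the three forms on the right; for
    [j != 0] the eigenvalue is an affine function of a cosine lying between
    [-1] and [cos (pi / n)], so it lies between the last two. *)
Lemma dihedral_eigenvalues_ge0 (R : realType) (n : nat) (p r : R) :
  (1 < n)%N ->
  (forall j : 'Z_(2 * n), 0 <= (if j == 0 then 2 * n%:R * r else 0) + (1 - r) +
     (p - r) * (2 * cos (j%:R * (pi / n%:R)))) <->
  [/\ 0 <= 1 + 2 * p + (2 * n%:R - 3) * r,
      0 <= 1 - r + 2 * cos (pi / n%:R) * (p - r) &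
      0 <= 1 - 2 * p + r].
Proof.
move=> n2; have N1 : (1 < 2 * n)%N by lia.
have n0 : 0 < n%:R :> R by rewrite ltr0n; lia.
split=> [ev|[ev0 ev1 evn] j].
  split.
  - by have := ev 0; rewrite eqxx mul0r cos0; lra.
  - by have := ev 1; rewrite oner_eq0 /= Zp_cast // modn_small // mul1r; lra.
  - have := ev (inZp n); rewrite -val_eqE /= Zp_cast // modn_small; last by lia.
    rewrite ifN -?lt0n; last by lia.
    by rewrite [n%:R * _]mulrCA divff ?gt_eqF // mulr1 cospi; lra.
have [->|j0] := eqVneq; first by rewrite mul0r cos0; lra.
have j2 := Zp_neq0_bounds N1 j0.
have := cos_mul_pi_div_le R n2 j2.
have := @cos_geN1 R (j%:R * (pi / n%:R)).
move: (cos (j%:R * _)) (cos (pi / _)) ev1 => x c ev1 x1 xc.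
have [rp|/ltW pr] := lerP r p.
  have : 0 <= (p - r) * (x + 1) by apply: mulr_ge0; lra.
  by lra.
have : 0 <= (r - p) * (c - x) by apply: mulr_ge0; lra.
by lra.
Qed.

(** * The three inequalities for the dihedral group *)

(** Along the walk, [phi (y^-1 x)] becomes the kernel [K]: [y^-1 x] is [s] or [t]
    exactly when [x] and [y] are consecutive vertices of the cycle. *)
Lemma positive_definite_dihedralP (R : realType) (n : nat) (hn : (2 <= n)%N)
    (s t : dihedral n) (hst : coxeter_generators s t)
    (p r : R) (phi : dihedral n -> R)
    (phi1 : phi 1%g = 1) (phis : phi s = p) (phit : phi t = p)
    (phiw : forall w : dihedral n, w != 1%g -> w != s -> w != t -> phi w = r) :
  positive_definite (fun w => (phi w)%:C%C) <->
  [/\ 0 <= 1 + 2 * p + (2 * n%:R - 3) * r,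
      0 <= 1 - r + 2 * cos (pi / n%:R) * (p - r) &
      0 <= 1 - 2 * p + r].
Proof.
have [gen s2 t2 stn] := hst.
have walk_b := dihedral_walk_bij hn s2 t2 stn gen (card_dihedral_gens hn).1.
rewrite -(dihedral_eigenvalues_ge0 p r hn).
pose K (m : 'Z_(2 * n)) : R[i] :=
  (if m == 0 then 1 else if (m == 1) || (m == -1) then p%:C else r%:C)%C.
rewrite (positive_definite_reindex (K := K) walk_b).
  have bochner := bochner_unitary_pairing K (dihedral_pairing R hn).
  apply: (iff_trans bochner).
  by split=> ev j; have := ev j; rewrite dihedral_spectrum // ler0c.
move=> k l; rewrite /K.
rewrite subr_eq0; case: eqVneq => [->|kl]; first by rewrite mulVg phi1.
have walk_inj := bij_inj walk_b.
rewrite -(dihedral_walk_neighbour hn s2 t2 stn _ _ walk_inj).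
case: ifP => [|/negbT]; rewrite !inE.
  by case/orP => /eqP ->; rewrite ?phis ?phit.
rewrite negb_or => /andP[ws wt]; rewrite phiw //.
by rewrite -eq_invg_mul invgK (inj_eq walk_inj) eq_sym.
Qed.

(** * The interval and the triangle *)

Lemma ineqs_interval (R : realFieldType) (n c p r : R) : 2 <= n -> 0 <= c ->
  [/\ 0 <= 1 + 2 * p + (2 * n - 3) * r, 0 <= 1 - r + 2 * c * (p - r) &
      0 <= 1 - 2 * p + r] <->
  Num.max ((- 2 * p - 1) / (2 * n - 3)) (2 * p - 1) <= r /\
  r <= (1 + 2 * p * c) / (1 + 2 * c).
Proof.
move=> n2 c0.
rewrite ge_max ler_pdivrMr; last by lra.
rewrite ler_pdivlMr; last by lra.
by split=> [[e0 e1 en]|[/andP[e0 en] e1]]; split; try (apply/andP; split); nra.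
Qed.

Lemma convex_hull3P (R : realFieldType) (M : lmodType R) (a b c x : M) :
  @convex_hull R M [set a; b; c] x <->
  exists u v w : R, [/\ 0 <= u, 0 <= v, 0 <= w, u + v + w = 1 &
                       x = u *: a + v *: b + w *: c].
Proof.
split=> [hull|[u [v [w [u0 v0 w0 uvw ->]]]] C [C_convex C_abc]].
  apply: (hull [set y | exists u v w : R, [/\ 0 <= u, 0 <= v, 0 <= w,
    u + v + w = 1 & y = u *: a + v *: b + w *: c]]); split=> [y z l|y /=].
    rewrite !inE; move=> [u [v [w [u0 v0 w0 uvw ->]]]].
    move=> [u' [v' [w' [u0' v0' w0' uvw' ->]]]].
    have l0 : 0 <= l%:num by exact: ge0.
    have l1 : 0 <= 1 - l%:num by rewrite subr_ge0 le1.
    exists (l%:num * u + (1 - l%:num) * u'), (l%:num * v + (1 - l%:num) * v'),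
      (l%:num * w + (1 - l%:num) * w').
    split; rewrite ?addr_ge0 ?mulr_ge0 //.
      transitivity (l%:num * (u + v + w) + (1 - l%:num) * (u' + v' + w')).
        by ring.
      by rewrite uvw uvw'; ring.
    transitivity (l%:num *: (u *: a + v *: b + w *: c) +
      (1 - l%:num) *: (u' *: a + v' *: b + w' *: c)); first by [].
    by rewrite !scalerDr !scalerA !scalerDl addrACA [X in X + _]addrACA.
  case=> [[]|] ->.
  - by exists 1, 0, 0; split; rewrite ?scale0r ?scale1r ?addr0 ?add0r.
  - by exists 0, 1, 0; split; rewrite ?scale0r ?scale1r ?addr0 ?add0r.
  - by exists 0, 0, 1; split; rewrite ?scale0r ?scale1r ?addr0 ?add0r.
have Ca : a \in C by rewrite inE; apply: C_abc; left; left.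
have Cb : b \in C by rewrite inE; apply: C_abc; left; right.
have Cc : c \in C by rewrite inE; apply: C_abc; right.
have C_mix (l : R) y z : 0 <= l <= 1 -> y \in C -> z \in C ->
    l *: y + (1 - l) *: z \in C.
  move=> /andP[l0 l1] Cy Cz.
  exact: (C_convex y z (Itv01 l0 l1) Cy Cz).
(* Nest two binary combinations, [c] being mixed with [b] first; for [u = 1]
   the inner weights would be 0 / 0. *)
rewrite -inE.
have [u1|u1] := eqVneq u 1.
  have [-> ->] : v = 0 /\ w = 0 by lra.
  by rewrite u1 scale1r !scale0r !addr0.
have u1' : 0 < 1 - u by rewrite subr_gt0 lt_neqAle u1; lra.
have -> : u *: a + v *: b + w *: c =
    u *: a + (1 - u) *: (v / (1 - u) *: b + (1 - v / (1 - u)) *: c).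
  rewrite scalerDr !scalerA -addrA; congr (_ + (_ *: _ + _ *: _)).
    by rewrite mulrC divfK // gt_eqF.
  rewrite mulrBr mulrC [_ * (v / _)]mulrC divfK ?gt_eqF //; lra.
apply: (C_mix) => //; first by lra.
apply: (C_mix) => //.
by rewrite divr_ge0 ?(ltW u1') //= ler_pdivrMr // mul1r; lra.
Qed.

(** Each affine form vanishes at two of the vertices, so at a combination of the
    vertices it is the weight of the third one times its positive value there. *)
Lemma ineqs_triangle (R : realFieldType) (n c p r : R) : 2 <= n -> 0 <= c ->
  [/\ 0 <= 1 + 2 * p + (2 * n - 3) * r, 0 <= 1 - r + 2 * c * (p - r) &
      0 <= 1 - 2 * p + r] <->
  triangle ((1 - n - c) / (1 + (2 * n - 1) * c), (1 - c) / (1 + (2 * n - 1) * c))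
    ((n - 2) / (2 * n - 2), - 1 / (n - 1)) (1, 1) (p, r).
Proof.
move=> n2 c0; rewrite /triangle convex_hull3P.
have D0 : 0 < 1 + (2 * n - 1) * c.
  have : 0 <= (2 * n - 1) * c by apply: mulr_ge0; lra.
  by lra.
have nc : 0 < n * (1 + c) by apply: mulr_gt0; lra.
split=> [[e0 e1 en]|[u [v [w [u0 v0 w0 uvw [-> ->]]]]]].
  (* The first weight vanishes on the line through the last two vertices, and
     is normalised to be 1 at the first vertex; likewise for the others. *)
  exists ((1 - 2 * p + r) * (1 + (2 * n - 1) * c) / (2 * (n * (1 + c)))).
  exists ((1 - r + 2 * c * (p - r)) * (n - 1) / (n * (1 + c))).
  exists ((1 + 2 * p + (2 * n - 3) * r) / (2 * n)).
  split.
  - by apply: divr_ge0; apply: mulr_ge0; lra.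
  - by apply: divr_ge0; [apply: mulr_ge0|]; lra.
  - by apply: divr_ge0; lra.
  - by field; lra.
  - by congr pair; rewrite /= /GRing.scale /=; field; lra.
rewrite /GRing.scale /= mulr1 (_ : w = 1 - u - v); last by lra.
split.
- rewrite (_ : 1 + _ + _ = 2 * n * w); first by apply: mulr_ge0; lra.
  rewrite (_ : w = 1 - u - v); last by lra.
  by field; lra.
- rewrite (_ : 1 - _ + _ = v * (n * (1 + c) / (n - 1))).
    by apply: mulr_ge0; [|apply: divr_ge0]; lra.
  by field; lra.
- rewrite (_ : 1 - _ + _ = u * (2 * (n * (1 + c)) / (1 + (2 * n - 1) * c))).
    by apply: mulr_ge0; [|apply: divr_ge0]; lra.
  by field; lra.
Qed.

Theorem corollary7p2 (R : realType) (n : nat) (hn : (2 <= n)%N)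
    (s t : dihedral n) (hst : coxeter_generators s t)
    (p r : R) (phi : dihedral n -> R)
    (phi1 : phi 1%g = 1) (phis : phi s = p) (phit : phi t = p)
    (phiw : forall w : dihedral n, w != 1%g -> w != s -> w != t -> phi w = r) :
  let c : R := cos (pi / n%:R) in
  (positive_definite (fun w => (phi w)%:C%C) <->
     Num.max ((- 2 * p - 1) / (2 * n%:R - 3)) (2 * p - 1) <= r /\
     r <= (1 + 2 * p * c) / (1 + 2 * c)) /\
  (positive_definite (fun w => (phi w)%:C%C) <->
     triangle
       ((1 - n%:R - c) / (1 + (2 * n%:R - 1) * c),
        (1 - c) / (1 + (2 * n%:R - 1) * c))
       ((n%:R - 2) / (2 * n%:R - 2), - 1 / (n%:R - 1))
       (1, 1) (p, r)).
Proof.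
move=> c; have n2 : 2 <= n%:R :> R by rewrite ler_nat.
have c0 : 0 <= c := cos_pi_div_ge0 R hn.
rewrite -ineqs_interval // -ineqs_triangle //.
have pdP := positive_definite_dihedralP hn hst phi1 phis phit phiw.
by split; [exact: pdP | exact: pdP].
Qed.
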